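(* Assume $\operatorname{non}(\mathcal N)=\mathfrak c$. Then $\mathcal{AN}_{\mathfrak c}$ is strongly $2^{\mathfrak c}$-algebrable in $\left(\mathbb R^{\mathbb R}\right)^{\mathfrak c}$.
   Context: For a regular infinite cardinal $\kappa$, a $\kappa$-sequence $(x_\alpha)_{\alpha<\kappa}$ converges to $x$ if for every neighbourhood $U$ of $x$ there is $\alpha_0<\kappa$ with $x_\alpha\in U$ for all $\alpha_0<\alpha<\kappa$; $\left(\mathbb R^{\mathbb R}\right)^{\kappa}$ is the commutative real algebra of $\kappa$-sequences of functions $\mathbb R\to\mathbb R$ with indexwise operations. $\operatorname{non}(\mathcal N)$ is the least cardinality of a non-null subset of $[0,1]$, $\mathfrak c=2^{\aleph_0}$. $\mathcal{AN}_{\kappa}$: $\kappa$-sequences of Lebesgue measurable functions $f_\alpha:\mathbb R\to\mathbb R$ converging pointwise a.e. to a function that is not Lebesgue measurable. $S$ is strongly $\mu$-algebrable if there is a set $X$ of $\mu$ algebraically independent elements such that every nonzero element of the (non-unital) algebra generated by $X$ belongs to $S$. *)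

(* Defs.v *)
From HB Require Import structures.
From mathcomp Require Import all_boot all_order all_algebra.
From mathcomp Require Import all_classical all_reals all_analysis.
From mathcomp Require mpoly.
Import (canonicals, coercions) mpoly.
Set Implicit Arguments. Unset Strict Implicit. Unset Printing Implicit Defensive.
Import Order.TTheory GRing.Theory Num.Theory.
Import numFieldNormedType.Exports.
Local Open Scope classical_set_scope.
Local Open Scope ring_scope.

Definition card_lt T U (A : set T) (B : set U) : Prop :=
  (A #<= B)%card /\ ~ (B #<= A)%card.

(* Lebesgue measurable subsets of R: the measurable sets of the completed
   Lebesgue measure (the Caratheodory sigma-algebra). *)
Definition Lmeasurable_set (R : realType) (A : set R) : Prop :=
  @measurable _ (caratheodory_type (@wlength R idfun)^*%mu) A.

Definition Lnull (R : realType) (A : set R) : Prop :=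
  (@completed_lebesgue_measure R).-negligible A.

Definition Lmeasurable_fun (R : realType) (f : R -> R) : Prop :=
  forall B : set (measurableTypeR R), measurable B -> Lmeasurable_set (f @^-1` B).

(* non(N) = c : every subset of [0,1] of cardinality < c is Lebesgue null
   (non(N) <= c always holds since [0,1] is not null). *)
Definition nonN_eq_c (R : realType) : Prop :=
  forall A : set R, A `<=` `[0, 1]%classic -> card_lt A [set: R] -> Lnull A.

(* I, with strict order lt, is (order-isomorphic to) the initial ordinal c:
   a strict well-order on a set of size c all of whose proper initial
   segments have size < c. *)
Definition is_ordinal_c (R : realType) (I : Type) (lt : I -> I -> Prop) : Prop :=
  (forall a b c, lt a b -> lt b c -> lt a c) /\ (forall a, ~ lt a a) /\
  [/\ 
      (forall a b, lt a b \/ a = b \/ lt b a),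
      well_founded lt,
      ([set: I] #= [set: R])%card &
      (forall a, card_lt [set b | lt b a] [set: R])].

Definition seq_cvg (I : Type) (lt : I -> I -> Prop) (T : topologicalType)
    (u : I -> T) (l : T) : Prop :=
  forall U, nbhs l U -> exists a0, forall a, lt a0 a -> U (u a).

Definition AN (R : realType) (I : Type) (lt : I -> I -> Prop) :
    set (I -> R -> R) :=
  [set f | (forall a, Lmeasurable_fun (f a)) /\
     exists g : R -> R, ~ Lmeasurable_fun g /\
       exists N : set R, Lnull N /\
         forall x, ~ N x -> seq_cvg lt (fun a => f a x) (g x)].

(* evaluation of a real polynomial in n variables at elements of the
   algebra (R^R)^I: the operations being indexwise and pointwise, this is
   pointwise evaluation. *)
Definition peval (R : realType) (I : Type) (n : nat)
    (P : mpoly.mpoly n R) (f : 'I_n -> I -> R -> R) : I -> R -> R :=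
  fun a x => mpoly.meval (fun i => f i a x) P.

(* S is strongly mu-algebrable in (R^R)^I, with mu the cardinality of the
   set M: there is X of cardinality #M of algebraically independent elements
   such that every nonzero element of the non-unital algebra generated by X
   lies in S. Equivalently: for distinct x_1..x_n in X and every nonzero
   polynomial P without constant term, P(x_1..x_n) is nonzero and in S. *)
Definition strongly_algebrable (R : realType) (I : Type) (M : Type)
    (S : set (I -> R -> R)) : Prop :=
  exists X : set (I -> R -> R), (X #= [set: M])%card /\
    forall (n : nat) (f : 'I_n -> I -> R -> R),
      injective f -> (forall i, X (f i)) ->
      forall P : mpoly.mpoly n R, P != 0 ->
        mpoly.mcoeff (@mpoly.mnm0 n) P = 0 ->
        peval P f <> (fun _ _ => 0) /\ S (peval P f).

(* Main.v *)
Require Import Defs.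
From mathcomp Require Import all_boot all_order all_algebra.
From mathcomp Require Import all_classical all_reals all_analysis.
From mathcomp Require Import lra.
From mathcomp Require mpoly.
Import (canonicals, coercions) mpoly.
Set Implicit Arguments. Unset Strict Implicit. Unset Printing Implicit Defensive.
Import Order.TTheory GRing.Theory Num.Theory.
Import numFieldNormedType.Exports.
Local Open Scope classical_set_scope.
Local Open Scope ring_scope.

(**
Let A range over all sets of reals. Hausdorff's independent functions [h_A],
defined on an index set [Xi] of size c, take any prescribed values
simultaneously at some index, for any finitely many distinct [A]. A transfinite
recursion of length c, in the manner of Bernstein, produces [p : R -> Xi] all of
whose fibres meet every non-null set [0,1] minus a countable union of intervals;
such a set is never exhausted by the fewer than c points already used, because
non(N) = c. Put [g_A = h_A \o p] on [0,1] and 0 elsewhere. A nonzero polynomial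
without constant term in distinct [g_A] takes the value 0 and some nonzero value
on fibres of [p], and so is not measurable. Now let [f_A a] agree with [g_A] at
the points of rank at most [a] and vanish elsewhere: it is supported on fewer
than c points, hence is null a.e., and at each point it is eventually equal to
[g_A]. Restricting to [0,1] avoids any use of translation invariance, and
regularity of c plays no role. *)

(** * Evaluation of polynomials in several variables *)

(** Reduction modulo [N] isolates the lowest digit. Serves both for exponent vectors of monomials
    and for binary codes of traces. *)
Lemma digits_inj (N n : nat) (a b : nat -> nat) :
  (forall i, (i < n)%N -> (a i < N)%N) -> (forall i, (i < n)%N -> (b i < N)%N) ->
  (\sum_(i < n) a i * N ^ i = \sum_(i < n) b i * N ^ i)%N ->
  forall i, (i < n)%N -> a i = b i.
Proof.
elim: n a b => // n IH a b aN bN; rewrite !big_ord_recl /= !expn0 !muln1.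
have shift (c : nat -> nat) : (\sum_(i < n) c (bump 0 i) * N ^ bump 0 i =
    (\sum_(i < n) c i.+1 * N ^ i) * N)%N.
  by rewrite big_distrl; apply: eq_bigr => i _; rewrite expnSr mulnA.
rewrite !shift => e.
have e0 : a 0%N = b 0%N.
  by have := congr1 (modn^~ N) e; rewrite /= ![(_ 0 + _)%N]addnC
    !modnMDl !modn_small ?aN ?bN.
move: e; rewrite e0 => /addnI /eqP.
rewrite eqn_pmul2r ?(leq_ltn_trans _ (aN 0%N _))//.
move=> /eqP e [//|i]; rewrite ltnS => ilt.
by apply: (IH (a \o S) (b \o S)) => // j jn /=; [apply: aN|apply: bN].
Qed.

Lemma mpoly_meval_neq0 (R : realType) (n : nat) (P : mpoly.mpoly n R) :
  P != 0 -> exists v : 'I_n -> R, mpoly.meval v P != 0.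
Proof.
(* [N] exceeds the degree of every monomial of [P], so exponent vectors are digit strings in base
   [N] and the weight [w] separates monomials. *)
move=> P0; set N := mpoly.mmeasure (@mpoly.mdeg n) P.
pose w (m : mpoly.multinom n) := (\sum_(i < n) m i * N ^ i)%N.
have w_inj m m' : m \in mpoly.msupp P -> m' \in mpoly.msupp P ->
    w m = w m' -> m = m'.
  have ltN k : k \in mpoly.msupp P -> forall i, (k i < N)%N.
    move=> /mpoly.msize_mdeg_lt kN i; apply: leq_ltn_trans kN.
    by rewrite mpoly.mdegE (bigD1 i)//= leq_addr.
  move=> mP m'P e; apply/mpoly.mnmP => i.
  pose ext (k : mpoly.multinom n) (j : nat) := oapp k 0%N (insub j : option 'I_n).
  have extE k (j : 'I_n) : ext k j = k j.
    by rewrite /ext insubT //= => ?; congr (k _); apply: val_inj.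
  have ltext k : k \in mpoly.msupp P -> forall j, (j < n)%N -> (ext k j < N)%N.
    by move=> kP j jn; rewrite -[j]/(val (Ordinal jn)) extE ltN.
  have := @digits_inj N n (ext m) (ext m') (ltext _ mP) (ltext _ m'P).
  under eq_bigr do rewrite extE.
  under [X in _ = X -> _]eq_bigr do rewrite extE.
  by move=> /(_ e i (ltn_ord i)); rewrite !extE.
pose q : {poly R} := \sum_(m <- mpoly.msupp P) (mpoly.mcoeff m P) *: 'X^(w m).
have [m0 m0P] : exists m0, m0 \in mpoly.msupp P.
  by exists (mpoly.mlead P); apply: mpoly.mlead_supp.
have q0 : q != 0.
  apply/eqP => /(congr1 (fun p : {poly R} => p`_(w m0))).
  rewrite coef0 coef_sum (bigD1_seq m0) ?mpoly.msupp_uniq//=.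
  rewrite coefZ coefXn eqxx mulr1.
  rewrite big_seq_cond big1 ?addr0; first by apply/eqP; rewrite -mpoly.mcoeff_msupp.
  move=> m /andP[mP mm0]; rewrite coefZ coefXn.
  by case: eqP => [/w_inj e|]; rewrite ?mulr0//; rewrite e ?eqxx in mm0.
have [t qt] : exists t, ~~ root q t.
  apply: contrapT => /forallNP h.
  (* The [size q] naturals below [size q] cannot all be roots. *)
  have := @max_poly_roots _ q (map (fun k => k%:R : R) (iota 0 (size q))) q0.
  rewrite size_map size_iota ltnn => H; suff: false by []; apply: H.
    by apply/allP => x _; have /negP := h x; rewrite negbK.
  by rewrite map_inj_uniq ?iota_uniq// => i j /eqP; rewrite eqr_nat => /eqP.
(* Kronecker's substitution X_i := t ^ (N ^ i) separates the monomials of P. *)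
exists (fun i => t ^+ (N ^ i)); apply: contra qt => /eqP e; apply/rootP.
rewrite -[RHS]e mpoly.mevalE horner_sum; apply: eq_bigr => m _.
rewrite hornerZ hornerXn; congr (_ * _); rewrite expr_sum.
by apply: eq_bigr => i _; rewrite mulnC exprM.
Qed.

Lemma meval_0 (R : realType) (n : nat) (P : mpoly.mpoly n R) :
  mpoly.meval (fun _ => 0) P = mpoly.mcoeff (@mpoly.mnm0 n) P.
Proof.
have prodE (m : mpoly.multinom n) :
    \prod_(i < n) (0 : R) ^+ m i = (m == @mpoly.mnm0 n)%:R.
  case: eqP => [->|/eqP m0]; first by rewrite big1// => i _; rewrite mpoly.mnm0E.
  have [i mi] : exists i, m i != 0%N.
    apply: contrapT => /forallNP h; case/eqP: m0; apply/mpoly.mnmP => i.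
    by rewrite mpoly.mnm0E; apply/eqP; have /negP := h i; rewrite negbK.
  by rewrite (bigD1 i)//= expr0n (negbTE mi) mul0r.
rewrite mpoly.mevalE; under eq_bigr do rewrite prodE.
have [i|i] := boolP (@mpoly.mnm0 n \in mpoly.msupp P).
  rewrite (bigD1_seq (@mpoly.mnm0 n)) ?mpoly.msupp_uniq//= eqxx mulr1 big1 ?addr0//.
  by move=> m /negbTE ->; rewrite mulr0.
rewrite big_seq_cond big1 ?mpoly.memN_msupp_eq0// => m /andP[mP _].
by case: eqP mP => [->|]; rewrite ?mulr0// (negbTE i).
Qed.

(** * Coding sequences of reals by single reals *)

Section CantorExpansion.
Variable R : realType.
Implicit Types b : nat -> bool.

Let S b n : R := \sum_(k < n) (b k)%:R * 3 ^- k.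

Let S_succ b n : S b n.+1 = S b n + (b n)%:R * 3 ^- n.
Proof. by rewrite /S big_ord_recr. Qed.

Let S_mono b : {homo S b : m n / (m <= n)%N >-> m <= n}.
Proof.
apply/nondecreasing_seqP => n; rewrite S_succ lerDl.
by rewrite mulr_ge0// invr_ge0 exprn_ge0.
Qed.

(** [3 / 2 * 3 ^- m] is the full geometric tail from [m] on; adding it makes the partial sums
    nonincreasing. *)
Let S_bound b m n : S b n <= S b m + 3 / 2 * 3 ^- m.
Proof.
have pos k : (0 : R) <= 3 ^- k by rewrite invr_ge0 exprn_ge0.
have [nm|mn] := leqP n m.
  by rewrite (le_trans (S_mono b nm))// lerDl; have := pos m; lra.
have dec : {homo (fun k => S b k + 3 / 2 * 3 ^- k) : k l / (k <= l)%N >-> l <= k}.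
  apply/nonincreasing_seqP => k.
  rewrite S_succ exprSr invfM.
  by have := pos k; case: (b k) => /=; lra.
by have := dec _ _ (ltnW mn); have := pos n; lra.
Qed.

Let E b : R := sup (range (S b)).

(** The first differing digit decides: it contributes [3 ^- k], all later ones together at most half
    of that. Base 2 would give only a weak inequality. *)
Let E_lt b b' k : (forall j, (j < k)%N -> b j = b' j) -> ~~ b k -> b' k ->
  E b < E b'.
Proof.
move=> agree bk b'k; have pos : (0 : R) < 3 ^- k by rewrite invr_gt0 exprn_gt0.
have Sk : S b k = S b' k by apply: eq_bigr => j _; rewrite agree.
have ub c m : ubound (range (S c)) (S c m + 3 / 2 * 3 ^- m).
  by move=> _ [n _ <-]; exact: S_bound.
have : E b <= S b k + 1 / 2 * 3 ^- k.
  apply: ge_sup; first by exists (S b 0); exists 0%N.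
  move=> _ [n _ <-]; have := S_bound b k.+1 n.
  rewrite S_succ (negbTE bk) mul0r exprSr invfM; lra.
have : S b' k.+1 <= E b'.
  apply: ub_le_sup; last by exists k.+1.
  by exists (S b' 0 + 3 / 2 * 3 ^- 0); exact: ub.
rewrite S_succ b'k -Sk -[(nat_of_bool true)%:R]/(1 : R); lra.
Qed.

Lemma ternary_injective : exists F : (nat -> bool) -> R, injective F.
Proof.
exists E => b b' eqE; apply/funext; apply: contrapT => /existsNP[k0 /eqP nk0].
have [k nk kmin] := ex_minnP (ex_intro (fun k => b k != b' k) k0 nk0).
have agree j : (j < k)%N -> b j = b' j.
  by move=> jk; apply/eqP; apply: contraTT jk => /kmin; rewrite -leqNgt.
case bk : (b k) nk; case b'k : (b' k) => // _.
- have := @E_lt b' b k; rewrite eqE ltxx b'k bk => H; suff: false by [].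
  by apply: H => // j jk; rewrite agree.
- have := @E_lt b b' k; rewrite eqE ltxx b'k bk => H; suff: false by [].
  by apply: H.
Qed.

End CantorExpansion.

Lemma dedekind_injective (R : realType) : exists D : R -> nat -> bool, injective D.
Proof.
pose D (x : R) (n : nat) : bool :=
  if (unpickle n : option rat) is Some q then ratr q < x else false.
have key (x y : R) : x < y -> D x <> D y.
  move=> /rat_in_itvoo[q]; rewrite in_itv/= => /andP[xq qy].
  move=> /(congr1 (fun g => g (pickle q))); rewrite /D pickleK qy => qx.
  by have := lt_trans xq qx; rewrite ltxx.
by exists D => x y e; case: (ltgtP x y) => // /key; rewrite e.
Qed.

(* Sequences of reals embed in R through Dedekind cuts and base 3 expansions. *)
Lemma real_onto_functions (R : realType) (J : countType) :
  exists s : R -> J -> R, forall c, exists x, s x = c.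
Proof.
have [F Fi] := ternary_injective R; have [D Di] := dedekind_injective R.
pose Phi (c : J -> R) : R :=
  F (fun n => if (unpickle n : option (J * nat)) is Some jm
              then D (c jm.1) jm.2 else false).
have Phii : injective Phi.
  move=> c d /Fi e; apply/funext => j; apply: Di; apply/funext => m.
  by have := congr1 (fun g => g (pickle (j, m))) e; rewrite /= pickleK.
exists (fun x => if pselect (exists c, Phi c = x) is left h
                 then projT1 (cid h) else fun=> 0).
move=> c; exists (Phi c); case: pselect => [h|]; last by case; exists c.
by case: cid => d /= /Phii.
Qed.

(** * Choice of distinct points by well-founded recursion *)

Lemma wf_avoiding_choice (I : Type) (T : pointedType) (lt : I -> I -> Prop)
    (K : I -> set T) : well_founded lt ->
  (forall i (h : I -> T), K i `\` (h @` [set j | lt j i]) !=set0) ->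
  exists x : I -> T, forall i, K i (x i) /\ forall j, lt j i -> x j <> x i.
Proof.
move=> wf ne.
(* Only earlier values are known at stage [i]; the default [point] extends them to a total function,
   to which [ne] applies. *)
pose ext i (rec : forall j, lt j i -> T) (j : I) : T :=
  if pselect (lt j i) is left p then rec j p else point.
pose step i (rec : forall j, lt j i -> T) : T := projT1 (cid (ne i (ext i rec))).
pose x := Fix wf (fun=> T) step.
have xE i : x i = step i (fun j _ => x j).
  rewrite /x Fix_eq// => k f g fg; congr (step k _).
  by apply: functional_extensionality_dep => j; apply: funext => p; exact: fg.
exists x => i; rewrite xE /step; case: cid => t /= [Kt nt]; split => // j ji e.
apply: nt; exists j => //; rewrite /ext; case: pselect => // p.
Qed.

(** * Lebesgue null and measurable sets *)

Definition outer_lebesgue (R : realType) (A : set R) : \bar R :=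
  ((@wlength R idfun)^*)%mu A.

Section LebesgueNull.
Variable R : realType.
Local Notation I01 := (`[0, 1]%classic : set R).
Local Notation l := (@outer_lebesgue R).

(** Outer measure zero forces Caratheodory measurability, so such a set is its own null cover. *)
Lemma Lnull_outerE (A : set R) : Lnull A <-> l A = 0%E.
Proof.
split=> [[B [mB B0 AB]]|A0].
  apply/eqP; rewrite eq_le outer_measure_ge0 andbT -B0.
  exact: le_outer_measure.
have mA : Lmeasurable_set A.
  apply: le_caratheodory_measurable => X.
  apply: (@le_trans _ _ (l A + l (X `&` ~` A))%E).
    by rewrite leeD2r// le_outer_measure//; exact: subIsetr.
  by rewrite A0 add0e le_outer_measure//; exact: subIsetl.
by exists A; split.
Qed.

Lemma Lnull_sub (A B : set R) : A `<=` B -> Lnull B -> Lnull A.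
Proof.
move=> AB [C [mC C0 BC]]; exists C; split => //.
exact: subset_trans BC.
Qed.

Lemma Lnull_Lmeasurable (A : set R) : Lnull A -> Lmeasurable_set A.
Proof. exact: negligible_sub_caratheodory. Qed.

Lemma outer_itv01 : l I01 = 1%E.
Proof.
have := @lebesgue_measure_itv R `[0, 1].
by rewrite /= lte_fin ltr01 -EFinD subr0.
Qed.

Lemma Lmeasurable_itv01 : Lmeasurable_set I01.
Proof. apply: sub_caratheodory. exact: measurable_itv. Qed.

Lemma itv01_not_Lnull : ~ Lnull I01.
Proof. by rewrite Lnull_outerE outer_itv01 => /eqP; rewrite onee_eq0. Qed.

Lemma Lnull_set1 (a : R) : Lnull [set a].
Proof. by apply/Lnull_outerE; exact: lebesgue_measure_set1. Qed.

(** Coded by endpoint sequences, these sets can be listed along an ordinal of length c. Left-open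
    intervals are those of the covers defining the outer measure. *)
Definition itv01_minus (s : nat -> R * R) : set R :=
  I01 `\` \bigcup_k `](s k).1, (s k).2]%classic.

(** As [D] has positive measure, its complement in [0,1] is covered by intervals of total length
    below 1. What they leave lies in [D] and is non-null by subadditivity. *)
Lemma Lmeasurable_contains_itv01_minus (D : set R) :
  D `<=` I01 -> Lmeasurable_set D -> ~ Lnull D ->
  exists s, itv01_minus s `<=` D /\ ~ Lnull (itv01_minus s).
Proof.
move=> D01 mD D0.
have mC : Lmeasurable_set (I01 `\` D).
  by apply: measurableD => //; exact: Lmeasurable_itv01.
have C1 : (l (I01 `\` D) < 1)%E.
  have e : (1 = l (I01 `\` D) + l D)%E.
    rewrite -outer_itv01 -[in X in (_ + X)%E](setIidr D01).
    exact: (@measureDI _ _ _ (@completed_lebesgue_measure R)) Lmeasurable_itv01 mD.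
  have l0 A : (0 <= l A)%E by exact: outer_measure_ge0.
  have Dn0 : l D != 0%E by apply/eqP => /Lnull_outerE.
  move: e (l0 D) (l0 (I01 `\` D)) Dn0.
  case: (l D) => [d| |]; case: (l (I01 `\` D)) => [c| |]//=.
  rewrite -EFinD !lee_fin lte_fin eqe => -[->] d0 c0 dn0.
  by rewrite ltrDl lt_neqAle eq_sym dn0.
move/ereal_inf_lt : C1 => [_ [A [mA CA] <-] A1].
have /choice[s sA] k : exists p : R * R, A k = `]p.1, p.2]%classic.
  by have [p _ <-] := mA k; exists p.
have V1 : (l (\bigcup_k A k) < 1)%E.
  apply: le_lt_trans A1; apply: ereal_inf_lbound; exists A => //; split => //.
have VE : \bigcup_k `](s k).1, (s k).2]%classic = \bigcup_k A k.
  by apply: eq_bigcup => // k _; rewrite sA.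
exists s; rewrite /itv01_minus VE; split.
  by move=> x [x01 nV]; apply: contrapT => nD; apply: nV; apply: CA.
move=> /Lnull_outerE K0; have : (1 < 1 :> \bar R)%E; last by rewrite ltxx.
rewrite -{1}outer_itv01; apply: le_lt_trans V1.
apply: (@le_trans _ _ (l (I01 `\` \bigcup_k A k) + l (\bigcup_k A k))%E).
  apply: le_trans (outer_measureU2 _ _ _); apply: le_outer_measure.
  by move=> x x01; have [?|?] := pselect ((\bigcup_k A k) x); [right|left].
by rewrite K0 add0e.
Qed.

End LebesgueNull.

(** A preimage of [B] is co-null if [B] contains 0 and null otherwise. *)
Lemma Lmeasurable_fun_null_support (R : realType) (N : set R) (f : R -> R) :
  Lnull N -> (forall x, ~ N x -> f x = 0) -> Lmeasurable_fun f.
Proof.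
move=> N0 fN B _; have [B0|B0] := pselect (B 0).
  rewrite -(setCK (f @^-1` B)); apply: measurableC; apply: Lnull_Lmeasurable.
  apply: Lnull_sub N0 => x nB; apply: contrapT => /fN fx; apply: nB.
  by rewrite /= fx.
apply: Lnull_Lmeasurable; apply: Lnull_sub N0 => x Bx.
by apply: contrapT => /fN fx; apply: B0; rewrite -fx.
Qed.

(* An index (n, F, psi): the trace of a set on F 0, ..., F (n - 1) is read as a
   number in binary and psi assigns a value to it. *)
Definition indep_index (R : realType) := (nat * (nat -> R) * (nat -> R))%type.

Definition indep_fun (R : realType) (xi : indep_index R) (A : set R) : R :=
  xi.2 (\sum_(k < xi.1.1) `[< A (xi.1.2 k) >] * 2 ^ k)%N.

(** Choose a point separating each pair of distinct sets. The traces on these finitely many points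
    have distinct codes, on which [psi] can be prescribed freely. *)
Lemma indep_funP (R : realType) (m : nat) (A : 'I_m -> set R) (r : 'I_m -> R) :
  injective A -> exists xi, forall i, indep_fun xi (A i) = r i.
Proof.
move=> Ai.
have /choice[x sep] (p : 'I_m * 'I_m) : exists x, p.1 <> p.2 ->
    `[< A p.1 x >] <> `[< A p.2 x >].
  have [e|ne] := pselect (p.1 = p.2); first by exists 0.
  apply: contrapT => /forallNP h; apply: ne; apply: Ai; apply/funext => x.
  have /not_implyP[_ /contrapT e] := h x.
  apply/propext; split=> H; apply/asboolP; first by rewrite -e; apply/asboolP.
  by rewrite e; apply/asboolP.
pose s := [seq x p | p <- enum {: 'I_m * 'I_m}].
pose code i := (\sum_(k < size s) `[< A i (nth 0%R s k) >] * 2 ^ k)%N.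
have code_inj : injective code.
  move=> i j e; apply: contrapT => ij.
  have /(nthP 0)[k ks sk] : x (i, j) \in s by apply: map_f; rewrite mem_enum.
  apply: (sep (i, j)) => //=; rewrite -sk.
  have := @digits_inj 2 (size s) (fun k => `[< A i (nth 0%R s k) >])
    (fun k => `[< A j (nth 0%R s k) >]).
  move=> /(_ _ _ e k ks) H.
  suff : `[< A i (nth 0 s k) >] = `[< A j (nth 0 s k) >] :> nat.
    by case: `[< _ >]; case: `[< _ >].
  by apply: H => l _; case: `[< _ >].
exists (size s, nth 0 s,
  fun v => if [pick i | code i == v] is Some i then r i else 0).
move=> i; rewrite /indep_fun /= -/(code i).
by case: pickP => [j /eqP /code_inj ->//|/(_ i)]; rewrite eqxx.
Qed.

(** * Bernstein's construction and non-measurability *)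

Section Bernstein.
Variables (R : realType) (I : Type) (lt : I -> I -> Prop).
Hypotheses (nonN : nonN_eq_c R) (ordI : @is_ordinal_c R I lt).

Lemma ordinal_c_bij : exists (f : I -> R) (g : R -> I), cancel f g /\ cancel g f.
Proof.
have [_ [_ [_ _ IR _]]] := ordI.
move/card_set_bijP: IR => [f]; rewrite setTT_bijective => -[g fg gf].
by exists f, g.
Qed.

Lemma Lnull_sub_small_image (T : Type) (A : set R) (h : T -> R) (B : set T) :
  card_lt B [set: R] -> A `<=` `[0, 1]%classic -> A `<=` h @` B -> Lnull A.
Proof.
move=> [BR nRB] A01 Ah; apply: nonN => //.
have AB : (A #<= B)%card.
  by apply: card_le_trans (card_image_le h B); exact: subset_card_le.
by split; [exact: card_le_trans BR|move=> RA; apply: nRB; exact: card_le_trans AB].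
Qed.

(** [e] lists the requirements. Stage [i] picks a new point of the required [K c], available since
    earlier points cover only a null part of it; distinctness makes [p] well defined at the chosen
    points. *)
Lemma Bernstein_fibration (C Xi : Type) (xi0 : Xi) (K : C -> set R)
    (e : I -> C * Xi) :
  (forall c, K c `<=` `[0, 1]%classic /\ ~ Lnull (K c)) ->
  (forall p, exists i, e i = p) ->
  exists p : R -> Xi, forall c xi, exists x, K c x /\ p x = xi.
Proof.
move=> KP es; case: ordI => _ [irr [tri wf _ small]].
have [|x xP] := @wf_avoiding_choice I R lt (fun i => K (e i).1) wf.
  move=> i h; apply: contrapT => /nonemptyPn E; have [K01 Kn] := KP (e i).1.
  apply: Kn; apply: (Lnull_sub_small_image (small i) K01 (h := h)).
  by move=> y Ky; apply: contrapT => nh; have : set0 y by rewrite -E.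
have xi : injective x.
  by move=> i j xij; case: (tri i j) => [/(xP j).2|[//|/(xP i).2]] //; rewrite xij.
exists (fun y => if pselect (exists i, x i = y) is left h
                 then (e (projT1 (cid h))).2 else xi0).
move=> c xi1; have [i ei] := es (c, xi1); exists (x i); split.
  by have := (xP i).1; rewrite ei.
case: pselect => [h|]; last by case; exists i.
by case: cid => j /= /xi ->; rewrite ei.
Qed.

Lemma Bernstein_index_map : exists p : R -> indep_index R, forall s xi,
  ~ Lnull (itv01_minus s) -> exists x, itv01_minus s x /\ p x = xi.
Proof.
have [f [g [_ gf]]] := ordinal_c_bij.
(* One real codes a whole requirement: a slot for [n], then slots for [F], for [psi], and for left
   ([true]) and right ([false]) endpoints. *)
pose J : countType := (unit + nat + nat + (nat * bool))%type.
have [s sP] := real_onto_functions R J.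
(* A null itv01_minus s is replaced by [0, 1], so that every K s is non-null. *)
pose K (s : nat -> R * R) : set R :=
  if pselect (Lnull (itv01_minus s)) then `[0, 1]%classic else itv01_minus s.
pose e i : (nat -> R * R) * indep_index R := let c := s (f i) in
  (fun k => (c (inr (k, true)), c (inr (k, false))),
   (Num.truncn (c (inl (inl (inl tt)))), (fun k => c (inl (inl (inr k)))),
    (fun k => c (inl (inr k))))).
have [|| p pP] := @Bernstein_fibration _ _ (0%N, (fun=> 0), (fun=> 0)) K e.
- move=> c; rewrite /K; case: pselect => [nK|nK]; split=> //.
    exact: itv01_not_Lnull.
  by move=> x [].
- move=> [c [[n F] psi]].
  have [x xE] := sP (fun j => match j with
    | inl (inl (inl _)) => n%:R
    | inl (inl (inr k)) => F k
    | inl (inr k) => psi k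
    | inr (k, b) => if b then (c k).1 else (c k).2 end).
  exists (g x); rewrite /e gf xE natrK; congr (_, _).
  by apply/funext => k; case: (c k).
exists p => c xi Kn; have [x] := pP c xi; rewrite /K; case: pselect => // nK Kx.
by exists x.
Qed.

End Bernstein.

(** Take the level set [E] of the nonzero value [phi xi1]. If null, its complement in [0,1] would
    meet the fibre over [xi1]; if measurable and non-null, [E] would meet the fibre over [xi0]. *)
Lemma Bernstein_not_Lmeasurable (R : realType) (Xi : Type) (p : R -> Xi)
    (phi : Xi -> R) (G : R -> R) (xi0 xi1 : Xi) :
  (forall s xi, ~ Lnull (itv01_minus s) -> exists x, itv01_minus s x /\ p x = xi) ->
  (forall x, `[0, 1]%classic x -> G x = phi (p x)) ->
  (forall x, ~ `[0, 1]%classic x -> G x = 0) ->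
  phi xi0 = 0 -> phi xi1 <> 0 -> ~ Lmeasurable_fun G.
Proof.
move=> pP G01 Gout phi0 phi1 mG.
pose E := G @^-1` [set phi xi1].
have mE : Lmeasurable_set E by apply: mG; exact: measurable_set1.
have E01 : E `<=` `[0, 1]%classic.
  by move=> x Ex; apply: contrapT => /Gout; rewrite Ex.
have K01 s : itv01_minus s `<=` (`[0, 1]%classic : set R) by move=> x [].
have [E0|En] := pselect (Lnull E).
  pose D : set R := `[0, 1]%classic `\` E.
  have [|||s [sD sn]] := @Lmeasurable_contains_itv01_minus R D.
  - by move=> x [].
  - by apply: measurableD => //; exact: Lmeasurable_itv01.
  - move=> D0; apply: (@itv01_not_Lnull R).
    have : Lnull (E `|` D) by exact: negligibleU.
    by apply: Lnull_sub => x x01; have [|] := pselect (E x); [left|right].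
  have [x [sx px]] := pP s xi1 sn.
  by have [_] := sD _ sx; apply; rewrite /E /= G01 ?px//; exact: K01 sx.
have [s [sE sn]] := Lmeasurable_contains_itv01_minus E01 mE En.
have [x [sx px]] := pP s xi0 sn.
have := sE _ sx; rewrite /E /= G01 ?px ?phi0; last exact: K01 sx.
by move=> /esym.
Qed.

(** * Algebrability of the truncated sequences *)

Theorem mainTheorem17 (R : realType) (I : Type) (lt : I -> I -> Prop) :
  nonN_eq_c R -> @is_ordinal_c R I lt ->
  strongly_algebrable (set R) (@AN R I lt).
Proof.
move=> nonN ordI.
have [p pP] := Bernstein_index_map nonN ordI.
have [f0 [rho [_ rhoK]]] := ordinal_c_bij ordI.
have [trans [irr [tri _ _ small]]] := ordI.
(* The points of [0,1] of rank at most [a], the rank being [rho]. *)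
pose supp a : set R := [set x | `[0, 1]%classic x /\ ~ lt a (rho x)].
have supp_null a : Lnull (supp a).
  have : Lnull ([set x | `[0, 1]%classic x /\ lt (rho x) a] `|`
      (`[0, 1]%classic `&` [set f0 a])).
    apply: negligibleU.
      apply: (Lnull_sub_small_image nonN (small a) (h := f0)) => [x []//|].
      by move=> x [_ xa]; exists (rho x).
    by apply: Lnull_sub (Lnull_set1 (f0 a)) => x [].
  apply: Lnull_sub => x [x01 xa].
  case: (tri (rho x) a) => [|[<-|//]]; first by left.
  by right; rewrite /= rhoK.
pose F (A : set R) (a : I) (x : R) : R :=
  if pselect (supp a x) then indep_fun (p x) A else 0.
have [s0 [_ s0n]] := @Lmeasurable_contains_itv01_minus R `[0, 1]%classic
  (fun _ => id) (@Lmeasurable_itv01 R) (@itv01_not_Lnull R).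
have hit xi : exists x, `[0, 1]%classic x /\ p x = xi.
  by have [x [[x01 _] px]] := pP s0 xi s0n; exists x.
have F_hit A x : `[0, 1]%classic x -> F A (rho x) x = indep_fun (p x) A.
  by move=> x01; rewrite /F; case: pselect => // -[]; split => //; exact: irr.
have F_inj : injective F.
  move=> A B FAB; apply: contrapT => AB.
  (* Prescribing 0 at [A] and 1 at [B] distinguishes [F A] from [F B]. *)
  pose S2 (i : 'I_2) := if val i == 0%N then A else B.
  have [|xi xiP] := @indep_funP R 2 S2 (fun i => (val i)%:R).
    by move=> [[|[|//]] ?] [[|[|//]] ?] // H; apply: val_inj => //; case: AB.
  have [x [x01 px]] := hit xi.
  have := congr1 (fun G => G (rho x) x) FAB.
  rewrite /= !F_hit// px.
  have := xiP ord0; have := xiP ord_max; rewrite /S2 /= => -> -> /eqP.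
  by rewrite eq_sym oner_eq0.
exists (range F); split.
  by apply: inj_card_eq => A B _ _; exact: F_inj.
move=> n f fi fX P P0 Pc.
have /choice[A AE] i : exists A, F A = f i by have [A _ <-] := fX i; exists A.
have Ai : injective A by move=> i j e; apply: fi; rewrite -!AE e.
have {fi fX AE} -> : f = fun i => F (A i) by apply/funext => i; rewrite AE.
have [v Pv] := mpoly_meval_neq0 P0.
have Pz : mpoly.meval (fun=> 0) P = 0 by rewrite meval_0.
have [xi1 xi1P] := indep_funP v Ai.
have [xi0 xi0P] := indep_funP (fun=> 0) Ai.
pose phi xi := mpoly.meval (fun i => indep_fun xi (A i)) P.
have phi0 : phi xi0 = 0.
  by rewrite -Pz; apply: mpoly.meval_eq => i; rewrite xi0P.
have phi1 : phi xi1 <> 0.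
  by apply/eqP; rewrite (_ : phi xi1 = mpoly.meval v P)//; apply: mpoly.meval_eq.
(* Off [supp a] all variables vanish together, and [P] has no constant term. *)
have pevalE a x : peval P (fun i => F (A i)) a x =
    if pselect (supp a x) then phi (p x) else 0.
  rewrite /peval; case: pselect => H.
    by apply: mpoly.meval_eq => i; rewrite /F; case: pselect.
  by rewrite -[RHS]Pz; apply: mpoly.meval_eq => i; rewrite /F; case: pselect.
split.
  move=> e; have [x [x01 px]] := hit xi1; apply: phi1.
  have := congr1 (fun G => G (rho x) x) e; rewrite /= pevalE px.
  by case: pselect => // -[]; split => //; exact: irr.
split.
  move=> a; apply: (Lmeasurable_fun_null_support (supp_null a)) => x nx.
  by rewrite pevalE; case: pselect.
exists (fun x => if pselect (`[0, 1]%classic x) then phi (p x) else 0); split.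
  apply: (Bernstein_not_Lmeasurable pP _ _ phi0 phi1) => x x01;
    by case: pselect.
(* Convergence holds everywhere: past stage [rho x] the value at [x] is constant. *)
exists set0; split; first exact: negligible_set0.
move=> x _ U /nbhs_singleton Ux; exists (rho x) => a ax; rewrite pevalE.
move: Ux; case: pselect => x01; case: pselect => //.
- by move=> -[]; split => // xa; apply: (irr a); exact: trans xa ax.
- by case.
Qed.
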